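(* Let $S$ be a finite generating $2$-separable subset of an abelian group $G$ with $1\in S$ and $\mu(S)\le0$. Assume moreover that $|S|\ne|G|-6$ if $\mu(S)=0$. Let $M$ be a $2$-atom of $S$ with $1\in M$ which is not a subgroup. Then $|M|=2$.
   Context: For a group $G$ and $S\subseteq G$, $\mathrm{Cay}(G,S)$ is the graph on $G$ with arcs $(x,y)$, $x^{-1}y\in S$; the image of $X$ is $XS$. For a reflexive locally finite graph $\Gamma=(V,E)$, $\partial(X)=\Gamma(X)\setminus X$; $\Gamma$ is $k$-separable if some finite $X$ has $|X|\ge k$ and $|V\setminus\Gamma(X)|\ge k$; then $\kappa_k(\Gamma)=\min\{|\partial(X)|: X\text{ finite},|X|\ge k,|V\setminus\Gamma(X)|\ge k\}$, a $k$-fragment is such an $X$ attaining the minimum, and a $k$-atom is a $k$-fragment of minimum cardinality. For $S$ with $1\in S$, these notions for $S$ refer to $\mathrm{Cay}(\langle S\rangle,S)$; $S$ is $k$-separable if this graph is. The defect is $\mu(S)=\kappa_2(S)-|S|$. (If $G$ is infinite, the condition $|S|\ne|G|-6$ is automatic.) *)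

(* Defs.v *)
(* An abelian group G is a zmodType (written additively:
   the identity 1 becomes 0, the product x*y becomes x + y).
   Finite subsets of G are represented by sequences; their cardinality
   is the number of distinct elements. *)
From HB Require Import structures.
From mathcomp Require Import all_boot all_order all_algebra.
From Stdlib Require Import ClassicalEpsilon.
Set Implicit Arguments. Unset Strict Implicit. Unset Printing Implicit Defensive.
Import Order.TTheory GRing.Theory Num.Theory.
Local Open Scope ring_scope.

Section CayleyDefs.
Variable G : zmodType.

Definition scard (X : seq G) : nat := size (undup X).

Definition generates (S : seq G) : Prop :=
  forall g : G, exists c : G -> int, g = \sum_(s <- undup S) s *~ c s.

Definition image (S X : seq G) : seq G :=
  undup [seq x + s | x <- X, s <- S].

Definition boundary (S X : seq G) : seq G :=
  [seq y <- image S X | y \notin X].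

Definition at_least (k : nat) (P : G -> Prop) : Prop :=
  exists s : seq G, uniq s /\ (k <= size s)%N /\ (forall y, y \in s -> P y).

Definition admissible (k : nat) (S X : seq G) : Prop :=
  (k <= scard X)%N /\ at_least k (fun y => y \notin image S X).

Definition separable (k : nat) (S : seq G) : Prop :=
  exists X, admissible k S X.

Definition is_kappa (k : nat) (S : seq G) (n : nat) : Prop :=
  (exists X, admissible k S X /\ scard (boundary S X) = n) /\
  (forall X, admissible k S X -> (n <= scard (boundary S X))%N).

(* kappa_k(S): the minimum (meaningful when S is k-separable) *)
Definition kappa (k : nat) (S : seq G) : nat :=
  epsilon (inhabits 0%N) (is_kappa k S).

Definition fragment (k : nat) (S X : seq G) : Prop :=
  admissible k S X /\
  (forall Y, admissible k S Y -> (scard (boundary S X) <= scard (boundary S Y))%N).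

Definition atom (k : nat) (S X : seq G) : Prop :=
  fragment k S X /\ (forall Y, fragment k S Y -> (scard X <= scard Y)%N).

Definition mu (S : seq G) : int := (kappa 2 S)%:Z - (scard S)%:Z.

Definition is_subgroup (X : seq G) : Prop :=
  0 \in X /\ (forall x y, x \in X -> y \in X -> x - y \in X).

Definition group_card_is (n : nat) : Prop :=
  exists e : seq G, uniq e /\ (forall g : G, g \in e) /\ size e = n.

End CayleyDefs.

(* Main.v *)
Require Import Defs.
From HB Require Import structures.
From mathcomp Require Import all_boot all_order all_algebra.
From mathcomp Require Import finmap zify.
From Stdlib Require Import Classical ClassicalEpsilon.
Import Order.TTheory GRing.Theory Num.Theory.
Local Open Scope ring_scope.

(** Put [k = kappa_2(S)] and [m = |M|], and suppose [m >= 3].  By submodularity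
    of [X |-> |X + S|], a translate of [M] meeting a fragment with a large
    enough co-image in two points lies inside it.  Hence distinct translates of
    [M] meet in at most one point: otherwise [M] would be a subgroup.

    If [G] is finite, [N = - (G \ (M + S))] is again a fragment, and
    [N + M] avoids [- S].  With [C] the set of [x] such that [M + x] lies in
    [N], distinct [N + a] and [N + b] ([a, b] in [M]) meet in at most [|C|]
    points, so that counting [N + {0, a, b}] bounds [|N|] in terms of [|C|].
    This gives [|N| >= 3m - 3], unless [m = |N| = 3] and [k = |S|], that is,
    [|G| = |S| + 6].

    For distinct nonzero [a, b] in [M], submodularity applied to
    [F' = M + {0, a, b}] gives [|F' + S| <= |F'| + 2k - |S|], which forces
    [k = |S|], and then [F'] is a fragment.  A further translate [M + c] would
    meet it in at least two points, hence be contained in it, so [m = 3].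
    Finally [P = (S + a) \ S] has three elements and [P + a = P + b].  Applying
    this to the three translates of [M] through [0] gives [3a = 0] and shows
    that [P] is invariant under [b] and [a - b], too much for a set of three
    elements. *)

(** * Sumsets, translates and points missed by a sumset *)

Section Sumsets.
Local Open Scope fset_scope.
Local Open Scope ring_scope.
Context {G : zmodType}.
Implicit Types (A B C U X Y Z S : {fset G}) (a x y z : G).

Definition translate A x : {fset G} := [fset y + x | y in A].
Definition sumset A B : {fset G} := [fset x + y | x in A, y in B].

Lemma in_translate A x z : (z \in translate A x) = (z - x \in A).
Proof.
apply/imfsetP/idP => [[y /= yA ->]|zA]; first by rewrite addrK.
by exists (z - x) => //=; rewrite subrK.
Qed.

Lemma card_translate A x : #|` translate A x| = #|` A|.
Proof. by rewrite card_imfset //=; apply: addIr. Qed.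

Lemma sumsetP A B z :
  reflect (exists2 x, x \in A & z - x \in B) (z \in sumset A B).
Proof.
apply: (iffP (imfset2P _ _ _ _ _)) => [[x /= xA [y /= yB ->]]|[x xA zB]].
  by exists x => //; rewrite addrC addKr.
by exists x => //=; exists (z - x) => //=; rewrite addrC subrK.
Qed.

Lemma sumsetS A B Z : A `<=` B -> sumset A Z `<=` sumset B Z.
Proof.
move=> /fsubsetP sAB; apply/fsubsetP => z /sumsetP[x xA zx].
by apply/sumsetP; exists x => //; apply: sAB.
Qed.

Lemma sumset_translate A x Z :
  sumset (translate A x) Z = translate (sumset A Z) x.
Proof.
apply/fsetP => z; rewrite in_translate; apply/sumsetP/sumsetP => -[y yA zy].
  by exists (y - x); [rewrite -in_translate | rewrite opprB addrA subrK].
exists (y + x); first by rewrite in_translate addrK.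
by rewrite opprD [- y - x]addrC addrA.
Qed.

Lemma sumsetU A B Z : sumset (A `|` B) Z = sumset A Z `|` sumset B Z.
Proof.
apply/fsetP => z; rewrite inE; apply/sumsetP/orP.
  by move=> [x /fsetUP[xA|xB] zx]; [left|right]; apply/sumsetP; exists x.
by move=> [|] /sumsetP[x xA zx]; exists x; rewrite // inE xA ?orbT.
Qed.

Lemma sumset1 x Z : sumset [fset x] Z = translate Z x.
Proof.
apply/fsetP => z; rewrite in_translate.
by apply/sumsetP/idP => [[y /fset1P ->] //|zx]; exists x; rewrite ?inE.
Qed.

(** Submodularity: the sumset of the intersection lies in both sumsets, possibly properly inside
    their intersection. *)
Lemma card_sumset_UI A B Z :
  (#|` sumset (A `|` B) Z| + #|` sumset (A `&` B) Z|
    <= #|` sumset A Z| + #|` sumset B Z|)%N.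
Proof.
rewrite sumsetU -(cardfsUI (sumset A Z)) leq_add2l; apply: fsubset_leq_card.
by rewrite fsubsetI !sumsetS // ?fsubsetIl ?fsubsetIr.
Qed.

Lemma card_fset_ge2 A x y : x \in A -> y \in A -> x != y -> (2 <= #|` A|)%N.
Proof.
move=> xA yA xy; have <- : #|` [fset x; y]| = 2%N by rewrite cardfs2 xy.
by apply: fsubset_leq_card; rewrite fsubUset !fsub1set xA.
Qed.

Lemma fset_ge2_exists A :
  (2 <= #|` A|)%N -> exists x y, [/\ x \in A, y \in A & x != y].
Proof.
move=> A2; have /fset0Pn[x xA] : A != fset0 by rewrite -cardfs_gt0; lia.
have /fset0Pn[y] : A `\ x != fset0.
  by rewrite -cardfs_gt0; move: A2; rewrite (cardfsD1 x) xA; lia.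
by rewrite !inE => /andP[yx yA]; exists x, y; rewrite eq_sym.
Qed.

(* The second half of admissibility, [|G \ (X + S)| >= k], meaningful also when
   [G] is infinite. *)
Definition colarge (S : {fset G}) (k : nat) X :=
  exists2 e : {fset G}, (k <= #|` e|)%N & {in e, forall y, y \notin sumset X S}.

Lemma colargeW S j k X : (j <= k)%N -> colarge S k X -> colarge S j X.
Proof. by move=> jk [e ke eX]; exists e => //; apply: leq_trans ke. Qed.

Lemma colargeS S k X Y : X `<=` Y -> colarge S k Y -> colarge S k X.
Proof.
move=> XY [e ke eX]; exists e => // y /eX; apply: contra.
by apply/fsubsetP/sumsetS.
Qed.

Lemma colarge_translate S k X x : colarge S k X -> colarge S k (translate X x).
Proof.
move=> [e ke eX]; exists (translate e x); first by rewrite card_translate.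
by move=> y; rewrite in_translate sumset_translate in_translate; apply: eX.
Qed.

(** Of [k] points outside [X + S], enlarging [X] to [Y] loses at most [|Y + S| - |X + S|]. *)
Lemma colarge_sup S j k X Y : X `<=` Y -> colarge S k X ->
  (j + #|` sumset Y S| <= k + #|` sumset X S|)%N -> colarge S j Y.
Proof.
move=> XY [e ke eX] jk; exists (e `\` sumset Y S); last first.
  by move=> y; rewrite inE => /andP[].
have sXY := sumsetS _ _ S XY.
have: (#|` e `&` sumset Y S| <= #|` sumset Y S `\` sumset X S|)%N.
  apply: fsubset_leq_card; apply/fsubsetP => y.
  by rewrite !inE => /andP[/eX -> ->].
have := fsubset_leq_card sXY; have := cardfsID (sumset Y S) e.
by rewrite (cardfsDS sXY); lia.
Qed.

(** Failure of [colarge] makes [G] finite: [e] is the whole complement of [X + S]. *)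
Lemma not_colarge S k X : ~ colarge S k X ->
  exists e : {fset G}, [/\ (#|` e| < k)%N, {in e, forall y, y \notin sumset X S}
    & forall g, (g \in sumset X S) || (g \in e)].
Proof.
elim: k => [|k IH] nk; first by case: nk; exists fset0.
have [[e ke eX]|/IH [e [ek eX eT]]] := classic (colarge S k X); last first.
  by exists e; split=> //; lia.
have ek : #|` e| = k.
  by apply/eqP; rewrite eqn_leq ke andbT leqNgt; apply/negP => ?; apply: nk; exists e.
exists e; split=> [||g]; rewrite ?ek //; apply: contraT; rewrite negb_or => /andP[gX ge].
case: nk; exists (g |` e); first by rewrite cardfsU1 ge ek.
by move=> y /fset1UP[->|/eX].
Qed.

(** * Reflection and elementary counting *)

Definition oppset A : {fset G} := [fset - y | y in A].

Lemma in_oppset A z : (z \in oppset A) = (- z \in A).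
Proof.
apply/imfsetP/idP => [[y /= yA ->]|zA]; first by rewrite opprK.
by exists (- z); rewrite ?opprK.
Qed.

Lemma card_oppset A : #|` oppset A| = #|` A|.
Proof. by rewrite card_imfset //=; apply: oppr_inj. Qed.

Lemma sumsetC A B : sumset A B = sumset B A.
Proof.
by apply/fsetP => z; apply/sumsetP/sumsetP => -[x xA zx];
  exists (z - x) => //; rewrite opprB addrC subrK.
Qed.

(** [- e + B] avoids [- A], since [- y + b = - a] would put [y = a + b] in [A + B]. *)
Lemma card_sumset_oppset U e A B : (forall g, g \in U) ->
  {in e, forall y, y \notin sumset A B} ->
  (#|` sumset (oppset e) B| + #|` A| <= #|` U|)%N.
Proof.
move=> allU eAB; have AU : A `<=` U by apply/fsubsetP.
have : (#|` sumset (oppset e) B| <= #|` oppset (U `\` A)|)%N.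
  apply: fsubset_leq_card; apply/fsubsetP => z /sumsetP[x].
  rewrite !in_oppset !inE allU andbT => /eAB nx zB; apply: contra nx => zA.
  by apply/sumsetP; exists (- z); rewrite // opprK addrC.
by rewrite card_oppset (cardfsDS AU); have := fsubset_leq_card AU; lia.
Qed.

Lemma card_fsetU3_ge A B C :
  (#|` A| + #|` B| + #|` C| <= #|` A `|` B `|` C|
     + (#|` A `&` B| + #|` A `&` C| + #|` B `&` C|))%N.
Proof.
have := cardfsUI A B; have := cardfsUI (A `|` B) C.
rewrite fsetIUl; have := cardfsUI (A `&` C) (B `&` C); lia.
Qed.

Lemma fset_ge3_exists2 A x : (3 <= #|` A|)%N -> x \in A ->
  exists y z, [/\ y \in A, z \in A, y != x, z != x & y != z].
Proof.
move=> A3 xA; have /fset_ge2_exists[y [z []]] : (2 <= #|` A `\ x|)%N.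
  by move: A3; rewrite (cardfsD1 x) xA; lia.
by rewrite !inE => /andP[yx yA] /andP[zx zA] yz; exists y, z.
Qed.

Lemma fset_ge3_exists A : (3 <= #|` A|)%N -> exists x y z,
  [/\ x \in A, y \in A, z \in A, y != x & (z != x) && (y != z)].
Proof.
move=> A3; have /fset0Pn[x xA] : A != fset0 by rewrite -cardfs_gt0; lia.
have [y [z [yA zA yx zx yz]]] := fset_ge3_exists2 _ _ A3 xA.
by exists x, y, z; rewrite zx.
Qed.

Lemma fset_ge4_exists A x y z : (4 <= #|` A|)%N ->
  exists w, [/\ w \in A, w != x, w != y & w != z].
Proof.
move=> A4; have /fset0Pn[w] : A `\ x `\ y `\ z != fset0.
  rewrite -cardfs_gt0; move: A4; rewrite (cardfsD1 x A) (cardfsD1 y (A `\ x)).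
  by rewrite (cardfsD1 z (A `\ x `\ y)); lia.
by rewrite !inE => /and4P[wz wy wx wA]; exists w.
Qed.

Lemma neq_addl a x : a != 0 -> x != a + x.
Proof. by apply: contra_neq; rewrite -{1}[x]add0r => /addIr. Qed.

Lemma leq_size_card_subr A x (s : seq G) :
  uniq s -> {in s, forall y, x - y \in A} -> (size s <= #|` A|)%N.
Proof.
move=> us sA; rewrite -(size_map (fun y => x - y)); apply: uniq_leq_size.
  by rewrite map_inj_uniq // => y z /addrI/oppr_inj.
by move=> _ /mapP[y ys ->]; apply: sA.
Qed.

Lemma translate0 A : translate A 0 = A.
Proof. by apply/fsetP => z; rewrite in_translate subr0. Qed.

End Sumsets.

(** * Absorption and intersections of translates of an atom *)

Section Atoms.
Local Open Scope fset_scope.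
Local Open Scope ring_scope.
Context {G : zmodType}.
Variables (S : {fset G}) (k m : nat).
Implicit Types (A B M X Y : {fset G}) (x y z a b : G).

Local Notation colarge := (colarge S).

(* [k] and [m] stand for [kappa_2(S)] and the cardinality of the 2-atoms of [S]. *)
Hypothesis isop : forall X, (2 <= #|` X|)%N -> colarge 2 X ->
  (#|` X| + k <= #|` sumset X S|)%N.
Hypothesis isop_small : forall X, (2 <= #|` X|)%N -> (#|` X| < m)%N ->
  colarge 2 X -> (#|` X| + k < #|` sumset X S|)%N.
Hypothesis m_ge3 : (3 <= m)%N.
Hypothesis k_le : (k <= #|` S|)%N.
Hypothesis card_neq : k = #|` S| ->
  ~ exists U : {fset G}, (forall g, g \in U) /\ #|` U| = (#|` S| + 6)%N.

(** A 2-atom through [0] that is not a subgroup; its minimality is carried by [isop] and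
    [isop_small]. *)
Definition proper_atom M :=
  [/\ #|` M| = m, #|` sumset M S| = (m + k)%N, colarge 2 M, 0 \in M
    & ~ {in M &, forall x y, x - y \in M}].

Lemma proper_atom_translate M a :
  proper_atom M -> a \in M -> proper_atom (translate M (- a)).
Proof.
move=> [cM cMS lM M0 nsubM] aM; split.
- by rewrite card_translate.
- by rewrite sumset_translate card_translate.
- exact: colarge_translate.
- by rewrite in_translate sub0r opprK.
move=> sub; apply: nsubM => x y xM yM.
have H z : z \in M -> z - a \in translate M (- a).
  by move=> zM; rewrite in_translate opprK subrK.
(* A difference-closed [M - a] contains [0] and [- a], hence [a]; so it also contains [x - y - a],
   that is, [x - y] is in [M]. *)
have Ha : a \in translate M (- a).
  by have := sub _ _ (H a aM) (H 0 M0); rewrite subrr !sub0r opprK.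
have := sub _ _ (sub _ _ (H x xM) (H y yM)) Ha.
by rewrite in_translate opprK subrK opprB addrA subrK.
Qed.

(** Otherwise [M & Y] has between 2 and [m - 1] points, so its sumset exceeds the bound of [isop]
    strictly. Submodularity then makes [M | Y] violate [isop]; its sumset gains at most [m - 3]
    points over [Y + S], so two points remain outside. *)
Lemma atom_absorb M Y : #|` M| = m -> #|` sumset M S| = (m + k)%N ->
  (#|` sumset Y S| <= #|` Y| + k)%N -> colarge m Y ->
  (2 <= #|` M `&` Y|)%N -> M `<=` Y.
Proof.
move=> cM cMS cYS lY I2; apply: contraT => nMY; exfalso.
have Im : (#|` M `&` Y| < m)%N.
  rewrite -cM ltnNge; apply: contra nMY => MI.
  by rewrite -[X in X `<=` _](_ : M `&` Y = M) ?fsubsetIr //;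
     apply/eqP; rewrite eqEfcard fsubsetIl.
have Y2 : (2 <= #|` Y|)%N by apply: leq_trans I2 (fsubset_leq_card (fsubsetIr _ _)).
have lY2 : colarge 2 Y by apply: colargeW lY; lia.
have hI := isop_small _ I2 Im (colargeS _ _ _ _ (fsubsetIr _ _) lY2).
have hUI := card_sumset_UI M Y S; have cUI := cardfsUI M Y.
have hY := isop _ Y2 lY2.
have YU : Y `<=` M `|` Y by apply: fsubsetUr.
have lU : colarge 2 (M `|` Y) by apply: colarge_sup YU lY _; lia.
have := isop _ (leq_trans Y2 (fsubset_leq_card YU)) lU; lia.
Qed.

(* [oppset e] is a 2-fragment of [S], because [x |-> - x] reverses the Cayley
   graph. *)
Lemma proper_atom_dual M j : proper_atom M -> ~ colarge j M ->
  exists e U : {fset G}, [/\ (2 <= #|` e| < j)%N,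
    {in e, forall y, y \notin sumset M S}, forall g, g \in U,
    #|` U| = (m + k + #|` e|)%N & colarge m (oppset e) /\
    (#|` sumset (oppset e) S| <= #|` oppset e| + k)%N].
Proof.
move=> [cM cMS [e0 e0_2 e0M] M0 nsubM] /not_colarge[e [ej eM eT]].
have e0e : e0 `<=` e.
  by apply/fsubsetP => y /e0M; have := eT y; case: (y \in sumset M S).
have cU : #|` sumset M S `|` e| = (m + k + #|` e|)%N.
  have := cardfsUI (sumset M S) e; rewrite cMS.
  suff -> : sumset M S `&` e = fset0 by rewrite cardfs0 addn0.
  apply/fsetP => y; rewrite !inE; apply/negP => /andP[+ /eM].
  by move=> ->.
exists e, (sumset M S `|` e); split=> //.
- by rewrite ej andbT; apply: leq_trans (fsubset_leq_card e0e).
- by move=> g; rewrite inE eT.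
split.
  exists (oppset M) => [|y]; first by rewrite card_oppset cM.
  rewrite in_oppset => yM; apply/sumsetP => -[x]; rewrite in_oppset => /eM/negP h.
  move=> yx; apply: h; apply/sumsetP; exists (- y) => //.
  by rewrite opprK addrC.
have : forall g, g \in sumset M S `|` e by move=> g; rewrite inE eT.
move/(card_sumset_oppset _ e M S)/(_ eM).
by rewrite cU cM card_oppset; lia.
Qed.

(** Otherwise the dual set would be a fragment with fewer than [m] elements. *)
Lemma proper_atom_colarge M : proper_atom M -> colarge m M.
Proof.
move=> aM; apply: NNPP => /(proper_atom_dual _ _ aM).
move=> [e [U [/andP[e2 em] _ _ _ [lN cN]]]].
have N2 : (2 <= #|` oppset e|)%N by rewrite card_oppset.
have lN2 : colarge 2 (oppset e) by apply: colargeW lN; lia.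
have := isop_small _ N2; rewrite [X in (X < m)%N]card_oppset => /(_ em lN2); lia.
Qed.

(** If two points were shared, absorption would make [M] stable under adding [d = x - y]. For each
    [a] in [M], the translate [M - a] would then meet [M] in [0] and [d], hence lie in [M], and [M]
    would be a subgroup. *)
Lemma proper_atom_sidon M x y : proper_atom M -> x != y ->
  (#|` translate M x `&` translate M y| <= 1)%N.
Proof.
move=> aM xy; have lM := proper_atom_colarge _ aM.
case: (aM) => cM cMS _ M0 nsubM.
have absorb u v : (2 <= #|` translate M u `&` translate M v|)%N ->
    translate M u `<=` translate M v.
  apply: atom_absorb; rewrite ?sumset_translate ?card_translate ?cMS ?cM //.
  exact: colarge_translate.
rewrite leqNgt; apply/negP => /absorb /fsubsetP sxy; apply: nsubM.
have step z : z \in M -> z + (x - y) \in M.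
  by move=> zM; rewrite addrA -in_translate sxy // in_translate addrK.
have d0 : 0 != x - y by rewrite eq_sym subr_eq0.
move=> b a bM aMem.
suff /fsubsetP : translate M (- a) `<=` translate M 0.
  by move/(_ (b - a)); rewrite !in_translate subr0 opprK subrK; apply.
apply: absorb; apply: (card_fset_ge2 _ 0 (x - y)) => //.
  by rewrite inE !in_translate subr0 sub0r opprK aMem.
rewrite inE !in_translate subr0 opprK addrC step //=.
by rewrite -[x - y]add0r step.
Qed.

(** * Lower bound for the co-image of an atom *)

Lemma proper_atom_exists2 M : proper_atom M ->
  exists a b, [/\ a \in M, b \in M, a != 0, b != 0 & a != b].
Proof. by move=> [cM _ _ M0 _]; apply: fset_ge3_exists2; rewrite ?cM. Qed.

Lemma proper_atom_dual_count M j : proper_atom M -> ~ colarge j M ->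
  exists N C U : {fset G}, [/\ (m <= #|` N| < j)%N,
    {in C, forall x, translate M x `<=` N}, forall g, g \in U,
    #|` U| = (m + k + #|` N|)%N &
    (2 * #|` N| + #|` S| <= 3 * #|` C| + m + k)%N].
Proof.
move=> aM nl; have [e [U [/andP[e2 ej] eM allU cU [lN cN]]]] := proper_atom_dual _ _ aM nl.
pose N := oppset e; have cNe : #|` N| = #|` e| by rewrite card_oppset.
have mN : (m <= #|` N|)%N.
  rewrite leqNgt; apply/negP => Nm.
  have : (#|` N| + k < #|` sumset N S|)%N.
    by apply: isop_small => //; [rewrite cNe | apply: colargeW lN; lia].
  by move: cN; rewrite -/N; lia.
case: (aM) => cM cMS _ M0 nsubM.
pose C : {fset G} := [fset x in N | translate M x `<=` N].
(* For [y] in both translates, [M + (y - (a + b))] contains [y - b] and [y - a], two points of [N],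
   so it is absorbed by [N]. *)
have inter a b : a \in M -> b \in M -> a != b ->
    (#|` translate N a `&` translate N b| <= #|` C|)%N.
  move=> aMem bMem ab; rewrite -(card_translate C (a + b)).
  apply: fsubset_leq_card; apply/fsubsetP => y.
  rewrite inE !in_translate => /andP[ya yb].
  have sN : translate M (y - (a + b)) `<=` N.
    apply: atom_absorb; rewrite ?sumset_translate ?card_translate //.
    apply: (card_fset_ge2 _ (y - b) (y - a)); rewrite ?inE ?in_translate ?ya ?yb ?andbT.
    - by rewrite opprB addrC addrA subrK addrK.
    - by rewrite opprB [a + b]addrC [X in X \in _]addrC addrA subrK addrK.
    - by apply: contra_neq ab => /addrI/oppr_inj.
  rewrite !inE sN andbT; apply: (fsubsetP sN).
  by rewrite in_translate subrr.
have [a [b [aMem bMem a0 b0 ab]]] := proper_atom_exists2 _ aM.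
exists N, C, U; split=> //.
- by rewrite mN cNe.
- by move=> x; rewrite !inE => /andP[].
- by rewrite cNe.
have := card_fsetU3_ge (translate N 0) (translate N a) (translate N b).
have := inter 0 a M0 aMem; rewrite eq_sym => /(_ a0).
have := inter 0 b M0 bMem; rewrite eq_sym => /(_ b0).
have := inter a b aMem bMem ab; rewrite !card_translate.
have : (#|` translate N 0%R `|` translate N a `|` translate N b|
         <= #|` sumset N M|)%N.
  apply: fsubset_leq_card; apply/fsubsetP => y; rewrite !inE !in_translate.
  by case/orP => [/orP[]|] h; apply/sumsetP; [exists (y - 0)|exists (y - a)|exists (y - b)];
    rewrite // opprB addrCA subrr addr0.
(* With [S] and [M] exchanged, [N + M] misses [- S], so it has at most [|U| - |S|] elements. *)
have : {in e, forall y, y \notin sumset S M} by rewrite sumsetC.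
move/(card_sumset_oppset _ _ _ _ allU); rewrite -/N cU cNe; lia.
Qed.

(** Two translates of [M] cover at least [2m - 1] points and three cover at least [3m - 3]. So
    [|N| < 2m - 1] forces [|C| <= 1], leaving only the case excluded by [card_neq]; then
    [2m - 1 <= |N| < 3m - 3] forces [|C| <= 2], and the count gives [3m <= 8]. *)
Lemma proper_atom_colarge3 M : proper_atom M -> colarge (3 * m - 3) M.
Proof.
move=> aM; case: (aM) => cM cMS _ M0 nsubM.
have l2 : colarge (2 * m - 1) M.
  apply: NNPP => /(proper_atom_dual_count _ _ aM).
  move=> [N [C [U [/andP[mN Nm] CN allU cU cNC]]]].
  have C1 : (#|` C| <= 1)%N.
    rewrite leqNgt; apply/negP => /fset_ge2_exists[x [y [xC yC xy]]].
    have := cardfsUI (translate M x) (translate M y).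
    rewrite !card_translate cM; have := proper_atom_sidon _ _ _ aM xy.
    have : translate M x `|` translate M y `<=` N by rewrite fsubUset !CN.
    move/fsubset_leq_card; lia.
  have [kS m3 N3] : [/\ k = #|` S|, m = 3%N & #|` N| = 3%N] by split; lia.
  by case: (card_neq kS); exists U; split=> //; lia.
apply: NNPP => /[dup] nl /(proper_atom_dual_count _ _ aM).
move=> [N [C [U [/andP[mN Nm] CN allU cU cNC]]]].
have C2 : (#|` C| <= 2)%N.
  rewrite leqNgt; apply/negP => /fset_ge3_exists[x [y [z [xC yC zC yx /andP[zx yz]]]]].
  have := card_fsetU3_ge (translate M x) (translate M y) (translate M z).
  rewrite !card_translate cM; have := proper_atom_sidon _ _ _ aM yx.
  have := proper_atom_sidon _ _ _ aM zx; have := proper_atom_sidon _ _ _ aM yz.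
  rewrite [translate M z `&` translate M x]fsetIC [translate M y `&` translate M x]fsetIC.
  have : translate M x `|` translate M y `|` translate M z `<=` N.
    by rewrite !fsubUset !CN.
  move/fsubset_leq_card; lia.
have [e e2 eM] := l2.
have eU : e `<=` U `\` sumset M S.
  by apply/fsubsetP => y ye; rewrite inE allU eM.
have MSU : sumset M S `<=` U by apply/fsubsetP => y _; apply: allU.
by move/fsubset_leq_card: eU; rewrite (cardfsDS MSU) cU cMS; lia.
Qed.

(** * Unions of three translates *)

Lemma proper_atom_addr_neq0 M a b : proper_atom M ->
  a \in M -> b \in M -> a != 0 -> a + b != 0.
Proof.
move=> aM aMem bMem a0; apply/negP => /eqP ab0; case: (aM) => _ _ _ M0 _.
have := proper_atom_sidon _ _ _ aM a0; rewrite translate0 leqNgt => /negP; apply.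
(* If [b = - a], then [M] and [M + a] share both [a] and [0]. *)
apply: (card_fset_ge2 _ a 0); rewrite // inE in_translate ?subrr ?aMem ?M0 //.
by rewrite sub0r andbT -[- a]addr0 -ab0 addKr.
Qed.

(** The pairwise intersections are the single points [a], [b] and [a + b]. Submodularity is applied
    twice: the sumset of [{a}] has [|S|] elements, and that of [{b, a + b}] at least [k + 3] since
    [2 < m]. *)
Lemma proper_atom_union3 M a b : proper_atom M ->
  a \in M -> b \in M -> a != 0 -> b != 0 -> a != b ->
  let F : {fset G} := M `|` translate M a in
  let F' : {fset G} := F `|` translate M b in
  [/\ #|` F| = (2 * m - 1)%N, (2 <= #|` translate M b `&` F|)%N,
    #|` F'| = (3 * m - 3)%N, colarge m F'
  & (#|` sumset F' S| + #|` S| <= #|` F'| + k + k)%N].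
Proof.
move=> aM aMem bMem a0 b0 ab F F'.
have sidon := proper_atom_sidon _ _ _ aM; case: (aM) => cM cMS lM M0 _.
have Ia := sidon _ _ a0; have Ib := sidon _ _ b0; have Iab := sidon _ _ ab.
rewrite !translate0 in Ia Ib.
have aI : a \in M `&` translate M a by rewrite inE aMem in_translate subrr.
have I1 : #|` M `&` translate M a| = 1%N.
  by apply/eqP; rewrite eqn_leq fsetIC Ia -fsetIC cardfs_gt0; apply/fset0Pn; exists a.
have cF : #|` F| = (2 * m - 1)%N.
  by have := cardfsUI M (translate M a); rewrite card_translate cM I1 -/F; lia.
have J2 : (2 <= #|` F `&` translate M b|)%N.
  apply: (card_fset_ge2 _ b (a + b)).
  - by rewrite /F !inE bMem !in_translate subrr M0.
  - by rewrite /F !inE !in_translate addrK aMem [a + b]addrC addrK bMem orbT.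
  - exact: neq_addl.
have cJ : #|` F `&` translate M b| = 2%N.
  apply/eqP; rewrite eqn_leq J2 andbT /F fsetIUl.
  have := cardfsUI (M `&` translate M b) (translate M a `&` translate M b).
  by move: Ib; rewrite fsetIC; lia.
have cF' : #|` F'| = (3 * m - 3)%N.
  by have := cardfsUI F (translate M b); rewrite card_translate cM cJ cF -/F'; lia.
have lJ : colarge 2 (F `&` translate M b).
  exact: colargeS (fsubsetIr _ _) (colarge_translate _ _ _ _ lM).
have Jm : (#|` F `&` translate M b| < m)%N by rewrite cJ.
have := isop_small _ J2 Jm lJ; have := card_sumset_UI F (translate M b) S.
have := card_sumset_UI M (translate M a) S.
rewrite -/F -/F' !sumset_translate !card_translate cMS cJ => h1 h2 h3.
have h4 : (#|` S| <= #|` sumset (M `&` translate M a) S|)%N.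
  rewrite -(card_translate S a) -sumset1; apply: fsubset_leq_card.
  by apply: sumsetS; rewrite fsub1set.
have cF'S : (#|` sumset F' S| + #|` S| <= #|` F'| + k + k)%N by lia.
split=> //; first by rewrite fsetIC.
have MF' : M `<=` F' by rewrite /F' /F -fsetUA fsubsetUl.
(* From [M + S] to [F' + S] at most [2m - 3] points are gained, so [m] of the [3m - 3] missed points
   survive. *)
by apply: colarge_sup MF' (proper_atom_colarge3 _ aM) _; lia.
Qed.

Lemma proper_atom_card M : proper_atom M -> k = #|` S| /\ m = 3%N.
Proof.
move=> aM; have [a [b [aMem bMem a0 b0 ab]]] := proper_atom_exists2 _ aM.
have := proper_atom_union3 _ _ _ aM aMem bMem a0 b0 ab; cbv zeta.
case: (aM) => cM cMS lM M0 _.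
set F := M `|` _; set F' := F `|` _ => -[cF _ cF' lF' cF'S].
have F'2 : (2 <= #|` F'|)%N by lia.
have := isop _ F'2 (colargeW _ _ _ _ (ltnW m_ge3) lF') => hF'.
split; first by lia.
apply/eqP; rewrite eqn_leq m_ge3 andbT leqNgt; apply/negP; rewrite -cM => M4.
have [c [cMem c0 ca cb]] := fset_ge4_exists _ 0 a b M4.
have sidon x : c != x -> (#|` translate M c `&` translate M x| <= 1)%N.
  exact: proper_atom_sidon.
(* The shared points are [c] in [M] and [a + c] in [M + a]. Each of the three translates forming
   [F'] covers at most one point of [M + c]. *)
have : translate M c `<=` F'.
  apply: atom_absorb; rewrite ?sumset_translate ?card_translate //; first by lia.
  apply: (card_fset_ge2 _ c (a + c)); rewrite ?inE ?in_translate.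
  - by rewrite subrr M0 cMem.
  - by rewrite addrK aMem addrAC subrr add0r cMem orbT.
  - exact: neq_addl.
move/fsetIidPl; rewrite /F' /F !fsetIUr => E.
have := sidon _ c0; have := sidon _ ca; have := sidon _ cb; rewrite translate0.
have := cardfsUI (translate M c `&` M) (translate M c `&` translate M a).
have := cardfsUI (translate M c `&` M `|` translate M c `&` translate M a)
  (translate M c `&` translate M b).
by rewrite E card_translate; lia.
Qed.

(** * The three-element set [P] and the contradiction *)

Lemma proper_atom_step M a b : proper_atom M ->
  a \in M -> b \in M -> a != 0 -> b != 0 -> a != b ->
  let P := sumset M S `\` S in
  let S2 := sumset (M `|` translate M a `|` translate M b) S in
  [/\ translate S a `\` S = P, #|` P| = 3%N & translate P a = S2 `\` sumset M S].
Proof.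
move=> aM aMem bMem a0 b0 ab P S2.
have [kS m3] := proper_atom_card _ aM.
have := proper_atom_union3 _ _ _ aM aMem bMem a0 b0 ab; cbv zeta.
case: (aM) => cM cMS lM M0 _.
set F := M `|` _; set F' := F `|` _ => -[cF F2 cF' lF' cF'S].
have SS1 : S `<=` sumset M S.
  by rewrite -[X in X `<=` _]translate0 -sumset1; apply: sumsetS; rewrite fsub1set.
(* [{0, a}] has fewer than [m] elements, so its sumset has at least [k + 3 = |M + S|] elements and
   fills [M + S]. *)
have S1E : S `|` translate S a = sumset M S.
  pose X : {fset G} := [fset 0] `|` [fset a].
  have XM : X `<=` M by rewrite fsubUset !fsub1set M0.
  have X2 : #|` X| = 2%N by rewrite cardfs2 eq_sym a0.
  have <- : sumset X S = S `|` translate S a by rewrite sumsetU !sumset1 translate0.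
  apply/eqP; rewrite eqEfcard sumsetS // andTb cMS.
  have := isop_small X; rewrite X2 => /(_ isT m_ge3 (colargeS _ _ _ _ XM lM)); lia.
have PE : translate S a `\` S = P by rewrite /P -S1E fsetDUl fsetDv fset0U.
have P3 : #|` P| = 3%N by rewrite /P (cardfsDS SS1) cMS; lia.
split=> //.
have FF' : F `<=` F' by apply: fsubsetUl.
(* As [|F| = 5] and [k = |S|], a smaller sumset would let [F] absorb [M + b]. *)
have cFS : (6 + #|` S| <= #|` sumset F S|)%N.
  rewrite leqNgt; apply/negP => cFS.
  have : translate M b `<=` F.
    apply: atom_absorb; rewrite ?sumset_translate ?card_translate //; first by lia.
    exact: colargeS FF' lF'.
  move/fsetUidPl => E; have : F' = F by rewrite /F' E.
  by move/(congr1 (fun A => #|` A|)); rewrite cF cF' m3.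
have cS2 : #|` S2| = (6 + #|` S|)%N.
  by have := fsubset_leq_card (sumsetS _ _ S FF'); rewrite -[S2]/(sumset F' S); lia.
have FS2 : sumset F S = S2.
  by apply/eqP; rewrite eqEfcard sumsetS // andTb cS2.
have S1S2 : sumset M S `<=` S2 by rewrite -FS2 sumsetS // fsubsetUl.
apply/esym/eqP; rewrite eqEfcard card_translate P3 (cardfsDS S1S2) cS2 cMS.
apply/andP; split; last by lia.
apply/fsubsetP => p; rewrite -FS2 /P sumsetU sumset_translate !inE !in_translate inE.
move=> /andP[pS1]; rewrite (negPf pS1) /= => ->; rewrite andbT.
by apply: contra pS1; rewrite -S1E !inE in_translate => ->; rewrite orbT.
Qed.
(** Exchanging [a] and [b] in the previous lemma changes neither [P] nor [S2], whence
    [P + a = P + b]. *)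
Lemma proper_atom_gap M a b : proper_atom M ->
  a \in M -> b \in M -> a != 0 -> b != 0 -> a != b ->
  let P : {fset G} := translate S a `\` S in
  [/\ #|` P| = 3%N, {in P, forall p, p + a \notin S}
    & {in P, forall p, p + (a - b) \in P}].
Proof.
move=> aM aMem bMem a0 b0 ab P; have ba : b != a by rewrite eq_sym.
have [PEa P3 PTa] := proper_atom_step _ _ _ aM aMem bMem a0 b0 ab.
have [PEb _ PTb] := proper_atom_step _ _ _ aM bMem aMem b0 a0 ba.
rewrite -/P in PEa; rewrite -PEa in P3 PTa PTb.
have SS1 : S `<=` sumset M S.
  case: (aM) => _ _ _ M0 _.
  by rewrite -[X in X `<=` _]translate0 -sumset1; apply: sumsetS; rewrite fsub1set.
have PT p : p \in P -> p + a \in translate P a by rewrite in_translate addrK.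
split=> // p /PT; rewrite PTa.
  by rewrite inE => /andP[+ _]; apply: contra; apply: (fsubsetP SS1).
by rewrite fsetUAC -PTb in_translate addrA.
Qed.

Lemma no_proper_atom M : ~ proper_atom M.
Proof.
move=> aM; have [a [b [aMem bMem a0 b0 ab]]] := proper_atom_exists2 _ aM.
have M0 : 0 \in M by case: aM.
have aMa := proper_atom_translate _ _ aM aMem.
have aMb := proper_atom_translate _ _ aM bMem.
have inT c d : d \in M -> d - c \in translate M (- c).
  by move=> dM; rewrite in_translate opprK subrK.
have in0 c : 0 \in M -> - c \in translate M (- c) by move/(inT c); rewrite sub0r.
have nz x : x != 0 -> - x != 0 by rewrite oppr_eq0.
have nzB x y : x != y -> x - y != 0 by rewrite subr_eq0.
have neB x y : x != 0 -> - y != x - y.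
  by apply: contra_neq; rewrite -[- y]add0r addrA addr0 => /addIr.
have ba : b != a by rewrite eq_sym.
have [P3 Pa Pab] := proper_atom_gap _ _ _ aM aMem bMem a0 b0 ab.
(* In [M - a] the pair is [- a, b - a], with difference [- b]; in [M - b] it is [- b, a - b], with
   difference [- a]. *)
have [] := proper_atom_gap _ _ _ aMa (in0 a M0) (inT a b bMem) (nz _ a0) (nzB _ _ ba) (neB _ _ b0).
have [] := proper_atom_gap _ _ _ aMb (in0 b M0) (inT b a aMem) (nz _ b0) (nzB _ _ ab) (neB _ _ a0).
set P := translate S a `\` S in P3 Pa Pab *.
set Pb := translate S (- b) `\` S; set Pa' := translate S (- a) `\` S.
move=> Pb3 _ Pba Pa3 _ Pab'.
have {}Pba : {in Pb, forall p, p - a \in Pb}.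
  by move=> p /Pba; rewrite opprB addKr.
have {}Pab' : {in Pa', forall p, p - b \in Pa'}.
  by move=> p /Pab'; rewrite opprB addKr.
have aa0 := proper_atom_addr_neq0 _ _ _ aM aMem aMem a0.
have bb0 := proper_atom_addr_neq0 _ _ _ aM bMem bMem b0.
have ab0 := proper_atom_addr_neq0 _ _ _ aM aMem bMem a0.
(* Otherwise [p], [p - a], [p - 2a], [p - 3a] would be four elements of [Pb]. *)
have a3 : a + a + a = 0.
  have /fset0Pn[p pPb] : Pb != fset0 by rewrite -cardfs_gt0 Pb3.
  apply/eqP/negPn/negP => a3.
  have us : uniq [:: 0; a; a + a; a + a + a].
    rewrite /= !inE !negb_or ![0 == _]eq_sym a0 aa0 a3 -addrA !neq_addl //.
    by rewrite addrA neq_addl.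
  suff /(leq_size_card_subr _ _ _ us) : {in [:: 0; a; a + a; a + a + a], forall c, p - c \in Pb} by rewrite Pb3.
  by apply/allP; rewrite /= subr0 !opprD !addrA !Pba // pPb.
(* For [q] in [P + a], [q] is outside [S] and [q - 2a] in [S]; the latter equals [q + a] because
   [3a = 0]. *)
have PaE : translate P a = Pa'.
  apply/eqP; rewrite eqEfcard card_translate P3 Pa3 leqnn andbT.
  apply/fsubsetP => q; rewrite in_translate => qP.
  have := Pa _ qP; rewrite subrK => qS; rewrite /Pa' inE qS in_translate opprK.
  have : q - a - a \in S by move: qP; rewrite inE in_translate => /andP[].
  suff -> : q - a - a = q + a by [].
  by apply: (addIr (a + a)); rewrite addrA !subrK -addrA [a + (a + a)]addrA a3 addr0.
have Pmb : {in P, forall p, p - b \in P}.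
  move=> p pP; have : p + a - b \in Pa' by rewrite Pab' // -PaE in_translate addrK.
  by rewrite -PaE in_translate addrAC addrK.
have /fset0Pn[p pP] : P != fset0 by rewrite -cardfs_gt0 P3.
(* Subtracting these from [p] stays in [P]; they are distinct because [a], [b], [2b], [a - b] and
   [a + b] are nonzero. *)
have us : uniq [:: 0; b; b + b; b - a].
  rewrite /= !inE !negb_or ![0 == _]eq_sym b0 bb0 subr_eq0 ba neq_addl //.
  rewrite [b - a]addrC neq_addl ?nz //= andbT.
  by rewrite [- a + b]addrC (inj_eq (addrI b)) -addr_eq0 addrC.
suff /(leq_size_card_subr _ _ _ us) : {in [:: 0; b; b + b; b - a], forall c, p - c \in P} by rewrite P3.
by apply/allP; rewrite /= subr0 opprB Pab // opprD addrA !Pmb // pP.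
Qed.

End Atoms.

(** * From sequences to finite sets *)

Section Bridge.
Local Open Scope fset_scope.
Local Open Scope ring_scope.
Context {G : zmodType}.
Implicit Types (S X Y : seq G).

Definition fset_of X : {fset G} := [fset x in X].

Lemma in_fset_of X x : (x \in fset_of X) = (x \in X).
Proof. by rewrite inE. Qed.

Lemma fset_ofK (A : {fset G}) : fset_of (enum_fset A) = A.
Proof. by apply/fsetP => x; rewrite in_fset_of. Qed.

Lemma scardE X : scard X = #|` fset_of X|.
Proof. by rewrite card_fseq. Qed.

Lemma mem_image S X y :
  (y \in Defs.image S X) = (y \in sumset (fset_of X) (fset_of S)).
Proof.
rewrite mem_undup; apply/allpairsP/sumsetP => [[[x s] [xX sS ->]]|[x]].
  by exists x; rewrite ?in_fset_of // addrAC subrr add0r.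
rewrite !in_fset_of => xX ys; exists (x, y - x); split=> //=.
by rewrite addrC subrK.
Qed.

(** [0] in [S] gives [X <= X + S], so the boundary is a set difference of nested sets. *)
Lemma scard_boundary S X : 0 \in S ->
  (#|` fset_of X| + scard (boundary S X) = #|` sumset (fset_of X) (fset_of S)|)%N.
Proof.
move=> S0; have sX : fset_of X `<=` sumset (fset_of X) (fset_of S).
  apply/fsubsetP => x xX; apply/sumsetP; exists x => //.
  by rewrite subrr in_fset_of.
have -> : scard (boundary S X) =
    #|` sumset (fset_of X) (fset_of S) `\` fset_of X|.
  rewrite scardE; congr #|` _|; apply/fsetP => y.
  by rewrite in_fset_of mem_filter mem_image in_fsetD in_fset_of.
by rewrite (cardfsDS sX) subnKC // fsubset_leq_card.
Qed.

Lemma admissibleP k S X : admissible k S X <->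
  (k <= #|` fset_of X|)%N /\ colarge (fset_of S) k (fset_of X).
Proof.
rewrite /admissible scardE; split=> -[kX b]; split=> //.
  have [s [us [ks sX]]] := b; exists (fset_of s).
    by rewrite -scardE /scard undup_id.
  by move=> y; rewrite in_fset_of -mem_image; apply: sX.
have [e ke eX] := b; exists (enum_fset e); split; first exact: fset_uniq.
by split=> // y /eX; rewrite mem_image.
Qed.

(** A fragment witnesses that the minimum exists, so the value chosen by [epsilon] is that
    minimum. *)
Lemma kappa_fragment k S X : fragment k S X -> kappa k S = scard (boundary S X).
Proof.
move=> [aX minX].
have kX : is_kappa k S (scard (boundary S X)) by split=> //; exists X.
have [[Y [aY eY]] minY] := epsilon_spec (inhabits 0%N) _ (ex_intro _ _ kX).
rewrite -/(kappa k S) in eY minY.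
by apply/eqP; rewrite eqn_leq minY //= -eY minX.
Qed.

End Bridge.

Theorem mainTheorem15 (G : zmodType) (S M : seq G) :
  generates S ->
  separable 2 S ->
  0 \in S ->
  mu S <= 0 ->
  (mu S = 0 -> ~ group_card_is G (scard S + 6)%N) ->
  atom 2 S M ->
  0 \in M ->
  ~ is_subgroup M ->
  scard M = 2%N.
Proof.
move=> _ _ S0 mu_le0 mu_eq0 [fM minM] M0 nsubM; have [aM minbM] := fM.
have [cM2 lM] := (admissibleP _ _ _).1 aM.
apply: NNPP => cM_neq2; set k := scard (boundary S M).
have kE : kappa 2 S = k := kappa_fragment _ _ _ fM.
rewrite /mu kE in mu_le0 mu_eq0.
have isop X : (2 <= #|` X|)%N -> colarge (fset_of S) 2 X ->
    (#|` X| + k <= #|` sumset X (fset_of S)|)%N.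
  rewrite -[X]fset_ofK => X2 lX; rewrite -scard_boundary // leq_add2l.
  by apply: minbM; apply/admissibleP.
apply: (no_proper_atom (fset_of S) k (scard M) isop _ _ _ _ (fset_of M)).
(* A set attaining the bound would be a fragment smaller than the atom [M]. *)
- move=> X X2 XM lX; rewrite ltnNge; apply/negP; move: X2 XM lX.
  rewrite -[X]fset_ofK => X2 XM lX; rewrite -scard_boundary // leq_add2l => bX.
  move: XM; rewrite -scardE ltnNge => /negP; apply; apply: minM.
  split=> [|Y aY]; first by apply/admissibleP.
  exact: leq_trans bX (minbM _ aY).
- by move: cM2 cM_neq2; rewrite -scardE; lia.
- by rewrite -scardE; lia.
- rewrite -scardE => kS [U [allU cU]]; apply: mu_eq0; first by lia.
  by exists (enum_fset U); split; [exact: fset_uniq | split].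
split=> //.
- by rewrite scardE.
- by rewrite -[LHS](scard_boundary S M S0) -scardE.
- by rewrite in_fset_of.
move=> sub; apply: nsubM; split=> // x y xM yM.
by rewrite -in_fset_of sub // in_fset_of.
Qed.
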